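(* Let $\pi\colon\widetilde Y\to Y$ be an unramified holomorphic covering map of complex manifolds. If $Y$ is subelliptic (respectively, elliptic), then $\widetilde Y$ is subelliptic (respectively, elliptic).
   Context: A spray on a complex manifold $Y$ is a holomorphic map $s\colon E\to Y$ from the total space of a holomorphic vector bundle $p\colon E\to Y$ such that $s(0_y)=y$ for all $y\in Y$, where $0_y$ is the zero element of $E_y=p^{-1}(y)$. A complex manifold $Y$ is subelliptic if it admits finitely many sprays $s_j\colon E_j\to Y$, $j=1,\dots,k$, such that $\sum_{j=1}^k(ds_j)_{0_y}(E_{j,y})=T_yY$ for every $y\in Y$ (here $E_{j,y}$ is regarded as a subspace of $T_{0_y}E_j=T_yY\oplus E_{j,y}$). It is elliptic if this holds with $k=1$, i.e. if it admits a single dominating spray. *)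

(* Defs.v *)
From HB Require Import structures.
From mathcomp Require Import all_boot all_order all_algebra.
From mathcomp Require Import complex.
From mathcomp Require Import boolp classical_sets functions reals topology.
From mathcomp Require Import normedtype derive.

Import Order.TTheory GRing.Theory Num.Theory.
Import numFieldNormedType.Exports.

Local Open Scope classical_set_scope.
Local Open Scope ring_scope.

(* Naming the structure lets the topology and norm that MathComp-Analysis puts
   on every numFieldType be inferred for the complex numbers. *)
Definition cplx (R : realType) : numClosedFieldType := R[i].

(* Charts, atlases and charted spaces are plain data; their axioms are the
   predicates is_chart and is_complex_manifold. The function cinv is total and
   only meaningful on the image of the chart. The dimension is attached to the
   chart, so the connected components of a manifold may differ in dimension. *)
Record chart (R : realType) (T : Type) := Chart {
  cdim : nat;
  cdom : set T;
  cmap : T -> 'rV[cplx R]_cdim;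
  cinv : 'rV[cplx R]_cdim -> T }.

Arguments Chart {R T}.
Arguments cdim {R T} c.
Arguments cdom {R T} c.
Arguments cmap {R T} c.
Arguments cinv {R T} c.

Definition cim {R : realType} {T : Type} (c : chart R T) :
    set 'rV[cplx R]_(cdim c) :=
  [set cmap c x | x in cdom c].

Definition is_chart {R : realType} {T : topologicalType} (c : chart R T) :
    Prop :=
  [/\ open (cdom c), open (cim c),
      {in cdom c, cancel (cmap c) (cinv c)},
      {in cdom c, continuous (cmap c)} &
      {in cim c, continuous (cinv c)}].

(* chart_at x is a preferred chart around x, used to represent T_xM. *)
Record charted_space (R : realType) := ChartedSpace {
  carrier :> topologicalType;
  atlas : set (chart R carrier);
  chart_at : carrier -> chart R carrier }.

Arguments ChartedSpace {R}.
Arguments carrier {R} c.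
Arguments atlas {R} c.
Arguments chart_at {R c} _.

(* Complex (Frechet) differentiability at all points of an open set is
   holomorphy; compare holomorphic_on below. *)
Definition is_complex_manifold {R : realType} (M : charted_space R) : Prop :=
  [/\ forall c : chart R M, atlas M c -> is_chart c,
      forall x : M, atlas M (chart_at x) /\ cdom (chart_at x) x,
      forall (c d : chart R M) (x : M), atlas M c -> atlas M d ->
        cdom c x -> cdom d x ->
        differentiable (cmap d \o cinv c) (cmap c x),
      hausdorff_space M &
      @second_countable M].

Record complex_manifold (R : realType) := ComplexManifold {
  charted :> charted_space R;
  manifoldP : is_complex_manifold charted }.

Arguments ComplexManifold {R}.
Arguments charted {R} c.
Arguments manifoldP {R} c.

(* Meant for open U. *)
Definition holomorphic_on {R : realType} {M N : charted_space R} (U : set M)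
    (f : M -> N) : Prop :=
  forall x : M, U x ->
    {for x, continuous f} /\
    forall (c : chart R M) (d : chart R N), atlas M c -> atlas N d ->
      cdom c x -> cdom d (f x) ->
      differentiable (cmap d \o f \o cinv c) (cmap c x).

Definition holomorphic {R : realType} {M N : charted_space R} (f : M -> N) :
    Prop :=
  holomorphic_on setT f.

Definition biholomorphic_on {R : realType} {M N : charted_space R} (U : set M)
    (V : set N) (f : M -> N) : Prop :=
  [/\ open U, open V, holomorphic_on U f, f @` U `<=` V &
      exists g : N -> M,
        [/\ holomorphic_on V g, g @` V `<=` U,
            {in U, cancel f g} & {in V, cancel g f}]].

(* The product M x C^r. *)
Definition prod_chart {R : realType} {T : Type} (r : nat) (c : chart R T) :
    chart R (T * 'rV[cplx R]_r) :=
  @Chart R (T * 'rV[cplx R]_r)%type (cdim c + r) [set z | cdom c z.1]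
    (fun z => row_mx (cmap c z.1) z.2)
    (fun v => (cinv c (lsubmx v), rsubmx v)).

Definition prod_space {R : realType} (M : charted_space R) (r : nat) :
    charted_space R :=
  @ChartedSpace R (M * 'rV[cplx R]_r)%type
    [set prod_chart r c | c in atlas M]
    (fun z => prod_chart r (chart_at z.1)).

(* T_xM, identified with C^n by the preferred chart at x. *)
Definition tangent {R : realType} {M : charted_space R} (x : M) :
    normedModType (cplx R) :=
  'rV[cplx R]_(cdim (chart_at x)).

(* The differential T_xM -> T_yN of f at x, for y = f x. The point y is a
   separate argument so that no transport along f x = y is needed. *)
Definition mdiff {R : realType} {M N : charted_space R} (f : M -> N) (x : M)
    (y : N) : tangent x -> tangent y :=
  'd (cmap (chart_at y) \o f \o cinv (chart_at x)) (cmap (chart_at x) x).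

(* The fibrewise operations are given as total functions; vadd e e' is only
   meaningful when e and e' lie in the same fibre. That they make the fibres
   vector spaces follows from the fibrewise linear local trivializations. *)
Record bundle_data {R : realType} (Y : complex_manifold R) := BundleData {
  total :> complex_manifold R;
  proj : total -> Y;
  vzero : Y -> total;
  vadd : total -> total -> total;
  vscale : cplx R -> total -> total }.

Arguments BundleData {R Y}.
Arguments total {R Y} b.
Arguments proj {R Y} b.
Arguments vzero {R Y} b.
Arguments vadd {R Y b}.
Arguments vscale {R Y b}.

Definition fiber {R : realType} {Y : complex_manifold R} (E : bundle_data Y)
    (y : Y) : set E :=
  [set e | proj E e = y].

Definition is_trivialization {R : realType} {Y : complex_manifold R}
    (E : bundle_data Y) (U : set Y) {r : nat} (h : E -> prod_space Y r) :
    Prop :=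
  [/\ biholomorphic_on (proj E @^-1` U)
        ([set z | U z.1] : set (prod_space Y r)) h,
      forall e : E, U (proj E e) -> (h e).1 = proj E e,
      forall y : Y, U y -> (h (vzero E y)).2 = 0,
      forall e e' : E, U (proj E e) -> proj E e = proj E e' ->
        (h (vadd e e')).2 = (h e).2 + (h e').2 &
      forall (a : cplx R) (e : E), U (proj E e) ->
        (h (vscale a e)).2 = a *: (h e).2].

Definition is_vector_bundle {R : realType} {Y : complex_manifold R}
    (E : bundle_data Y) : Prop :=
  [/\ holomorphic (proj E),
      forall y : Y, proj E (vzero E y) = y,
      forall e e' : E, proj E e = proj E e' -> proj E (vadd e e') = proj E e,
      forall (a : cplx R) (e : E), proj E (vscale a e) = proj E e &
      forall y : Y, exists (U : set Y) (r : nat) (h : E -> prod_space Y r),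
        [/\ open U, U y & is_trivialization E U h]].

Record vector_bundle {R : realType} (Y : complex_manifold R) := VectorBundle {
  vdata :> bundle_data Y;
  vector_bundleP : is_vector_bundle vdata }.

Arguments VectorBundle {R Y}.
Arguments vdata {R Y} v.
Arguments vector_bundleP {R Y} v.

(* For e in E_y, the tangent vector at 0_y of the curve t |-> t e: this is the
   inclusion of E_y in T_{0_y}E. *)
Definition vertical {R : realType} {Y : complex_manifold R}
    {E : vector_bundle Y} (y : Y) (e : E) : tangent (vzero E y) :=
  'D_1 (fun t : cplx R => cmap (chart_at (vzero E y)) (vscale t e)) 0.

Record spray {R : realType} (Y : complex_manifold R) := Spray {
  spray_bundle : vector_bundle Y;
  spray_map :> spray_bundle -> Y;
  spray_holomorphic : holomorphic spray_map;
  spray_zero : forall y : Y, spray_map (vzero spray_bundle y) = y }.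

Arguments Spray {R Y}.
Arguments spray_bundle {R Y} s.
Arguments spray_map {R Y} s.
Arguments spray_holomorphic {R Y} s.
Arguments spray_zero {R Y} s.

(* The subspace (ds)_{0_y}(E_y) of T_yY. *)
Definition spray_image {R : realType} {Y : complex_manifold R} (s : spray Y)
    (y : Y) : set (tangent y) :=
  let E := spray_bundle s in
  [set mdiff s (vzero E y) y (vertical y e) | e in fiber E y].

Definition dominating {R : realType} {Y : complex_manifold R} {k : nat}
    (s : 'I_k -> spray Y) : Prop :=
  forall (y : Y) (w : tangent y), exists2 v : 'I_k -> tangent y,
    (forall j : 'I_k, spray_image (s j) y (v j)) & w = \sum_(j < k) v j.

Definition subelliptic {R : realType} (Y : complex_manifold R) : Prop :=
  exists (k : nat) (s : 'I_k -> spray Y), dominating s.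

Definition elliptic {R : realType} (Y : complex_manifold R) : Prop :=
  exists s : 'I_1 -> spray Y, dominating s.

(* The sheets over V form the set of sets F. Surjectivity is not required:
   F may be empty. *)
Definition evenly_covered {R : realType} {X Y : complex_manifold R}
    (p : X -> Y) (V : set Y) : Prop :=
  exists F : set (set X),
    [/\ p @^-1` V = \bigcup_(S in F) S, trivIset F id &
        forall S : set X, F S -> biholomorphic_on S V p].

Definition holomorphic_covering {R : realType} {X Y : complex_manifold R}
    (p : X -> Y) : Prop :=
  holomorphic p /\
  forall y : Y, exists V : set Y, [/\ open V, V y & evenly_covered p V].

(* Main.v *)
Require Import Defs.
From HB Require Import structures.
From mathcomp Require Import all_boot all_order all_algebra.
From mathcomp Require Import complex.
From mathcomp Require Import boolp classical_sets functions cardinality.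
From mathcomp Require Import reals topology.
From mathcomp Require Import normedtype landau derive lra.

Import Order.TTheory GRing.Theory Num.Theory.
Import numFieldNormedType.Exports.

Local Open Scope classical_set_scope.
Local Open Scope ring_scope.

(* Pull the bundle E of a spray s on Y back along p to the bundle E' of pairs
   (x, e) with p x = proj e. Since the fibres of E' contract to zero, the map
   (x, e) |-> s e lifts through p: send (x, e) to the endpoint of the lift,
   starting at x, of the path t |-> s (t e), 0 <= t <= 1. The endpoint map s' is
   continuous by homotopy lifting, hence holomorphic because p is locally
   biholomorphic, and p s' = s q for the projection q : E' -> E. As dp is
   bijective, ds' (E'_x) is the preimage of ds (E_(p x)) under dp, so dominating
   families lift to dominating families of the same size. *)

(** * Homotopy lifting *)

(** Lifting paths one by one puts no connectedness condition on E', unlike the criterion through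
    fundamental groups. Uniqueness of path lifting then determines the endpoint; in particular s'
    fixes the zero section, because the path of a zero vector is constant.

    The complex structure of E' is transported from E along q, which is a local homeomorphism, being
    a base change of p. In the preferred charts q is the identity near the base point, so E' and E
    have the same tangent spaces and vertical vectors by conversion, and d(s q) is ds without
    further computation. The price is that the charts of E' see only the component in E: holomorphy
    of the projection E' -> Y' and of the trivializations has to be recovered from local sections of
    p. *)

Lemma near_eq_continuous_at {T U : topologicalType} (f g : T -> U) (x : T) :
  (\forall z \near x, f z = g z) -> {for x, continuous f} ->
  {for x, continuous g}.
Proof.
move=> fg cf A; rewrite -(nbhs_singleton fg) => /cf /= fA.
by apply: (filterS2 _ _ fg fA) => z; rewrite /= => ->.
Qed.

Lemma near_fst {T U : topologicalType} (z : T * U) (P : set T) :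
  (\forall x \near z.1, P x) -> \forall w \near z, P w.1.
Proof.
by move=> Px; exists (P, setT) => [|w []//]; split=> //; exact: filterT.
Qed.

Lemma near_snd {T U : topologicalType} (z : T * U) (P : set U) :
  (\forall x \near z.2, P x) -> \forall w \near z, P w.2.
Proof.
by move=> Px; exists (setT, P) => [|w []//]; split=> //; exact: filterT.
Qed.

Lemma continuous_pair {S T U : topologicalType} (f : S -> T) (g : S -> U) x :
  {for x, continuous f} -> {for x, continuous g} ->
  {for x, continuous (fun z => (f z, g z))}.
Proof.
move=> cf cg A [[P Q] /= [/cf /= Pf /cg /= Qg] PQ].
apply: (@filterS2 _ (nbhs x) _ _ _ _ _ Pf Qg) => z Pz Qz.
by apply: (PQ (f z, g z)).
Qed.

Lemma continuous_sectionl {T U V : topologicalType} (g : T * U -> V) x u :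
  {for (x, u), continuous g} -> {for x, continuous (fun z => g (z, u))}.
Proof.
move=> cg A /cg [[P Q] /= [Px Qu] PQ]; apply: filterS Px => z Pz.
by apply: (PQ (z, u)); split=> //=; exact: nbhs_singleton.
Qed.

Lemma continuous_sectionr {T U V : topologicalType} (g : T * U -> V) x u :
  {for (x, u), continuous g} -> {for u, continuous (fun z => g (x, z))}.
Proof.
move=> cg A /cg [[P Q] /= [Px Qu] PQ]; apply: filterS Qu => z Pz.
by apply: (PQ (x, z)); split=> //=; exact: nbhs_singleton.
Qed.

(** Compactness of [0, 1] in the form of a supremum argument. [P] passes between any two points near
    [T], in either direction, so a point of the set slightly below the supremum carries [P] beyond
    it. *)
Lemma segment_induction {R : realType} (P : R -> Prop) :
  P 0 ->
  (forall T : R, 0 <= T <= 1 -> exists2 e : R, 0 < e &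
    forall t u : R, 0 <= t <= 1 -> 0 <= u <= 1 ->
      `|t - T| < e -> `|u - T| < e -> P t -> P u) ->
  P 1.
Proof.
move=> P0 loc; pose S := [set t : R | 0 <= t <= 1 /\ P t].
have S0 : S 0 by split=> //; rewrite lexx ler01.
have ubS : ubound S 1 by move=> t [/andP[]].
have hS : has_sup S by split; [exists 0 | exists 1].
have supS1 : sup S <= 1 by apply: ge_sup; first by exists 0.
have supS0 : 0 <= sup S by apply: ub_le_sup => //; exists 1.
have [|e e0 He] := loc (sup S); first by rewrite supS0.
have [t [t01 Pt] tS] := sup_adherent e0 hS.
have tleS : t <= sup S by apply: ub_le_sup => //; exists 1.
have dt : `|t - sup S| < e by rewrite ltr_norml; lra.
(* The truncated point lies in [S]. It would exceed [sup S] unless the cap 1 is active, so [sup S]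
   is 1. *)
have /(@le_trans _ _ _ _ _) : Num.min 1 (sup S + e / 2) <= sup S.
  apply: ub_le_sup; first by exists 1.
  have m01 : 0 <= Num.min 1 (sup S + e / 2) <= 1.
    by rewrite le_min ge_min lexx ler01 /= andbT; lra.
  split=> //; apply: (He t) => //.
  by rewrite ltr_norml; case: (leP 1 (sup S + e / 2)); lra.
case: (leP 1 (sup S + e / 2)) => [_ /(_ _ (lexx _)) S1|_ /(_ _ (lexx _))];
  last first.
  lra.
apply: (He t) => //; first by rewrite lexx ler01.
by rewrite ltr_norml; lra.
Qed.

(* [tr x y] is the point over [y] in the sheet through [x]. *)
Definition is_transport {X B : topologicalType} (p : X -> B) (V : set B)
    (tr : X -> B -> X) : Prop :=
  forall x : X, V (p x) ->
    [/\ tr x (p x) = x,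
        forall y : B, V y -> [/\ p (tr x y) = y, {for y, continuous (tr x)} &
          {in V, tr (tr x y) =1 tr x}] &
        \forall x' \near x, {in V, tr x' =1 tr x}].

(** Even covering is expressed by sections through points instead of a family of disjoint sheets, so
    that local lifts are given by a formula. *)
Definition topological_covering {X B : topologicalType} (p : X -> B) : Prop :=
  forall y : B, exists (V : set B) (tr : X -> B -> X),
    [/\ open V, V y & is_transport p V tr].

Section Lifting.
Context {R : realType} {X Y B : topologicalType}.
Variables (p : X -> B) (H : Y * R -> B).
Hypotheses (covp : topological_covering p) (cH : continuous H).

(** The sheet depends locally constantly on its point, so near [z] the map agrees with [H] followed
    by the single section [tr (b z.1)]. *)
Lemma transport_continuous_at (V : set B) (tr : X -> B -> X) (b : Y -> X)
    (z : Y * R) :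
  open V -> is_transport p V tr -> {for z.1, continuous b} -> V (p (b z.1)) ->
  V (H z) -> {for z, continuous (fun w => tr (b w.1) (H w))}.
Proof.
move=> oV trV cb Vb Vz; have [_ ctr ntr] := trV _ Vb.
have [_ cz _] := ctr _ Vz.
apply: (@near_eq_continuous_at _ _ (tr (b z.1) \o H)); last first.
  by apply: continuous_comp; [exact: cH | exact: cz].
have VH : \forall w \near z, V (H w) by apply: cH; exact: open_nbhs_nbhs.
have tb : \forall w \near z, {in V, tr (b w.1) =1 tr (b z.1)}.
  apply: (near_fst z (fun x => {in V, tr (b x) =1 tr (b z.1)})).
  exact: cb ntr.
near=> w; rewrite /= (near tb w) //.
by apply/mem_set; near: w.
Unshelve. all: by end_near. Qed.

(** Near [T] each lift stays in one sheet and is recovered from it by transport along [H]. Agreement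
    at one time makes the two sheets equal over [V], hence the lifts agree at every nearby time. *)
Lemma path_lift_unique (y : Y) (g1 g2 : R -> X) :
  (forall t, 0 <= t <= 1 ->
    {for t, continuous g1} /\ {for t, continuous g2}) ->
  (forall t, 0 <= t <= 1 -> p (g1 t) = H (y, t) /\ p (g2 t) = H (y, t)) ->
  g1 0 = g2 0 -> g1 1 = g2 1.
Proof.
move=> cg pg g0; apply: (segment_induction (fun t => g1 t = g2 t)) => // T T01.
have [V [tr [oV VT trV]]] := covp (H (y, T)).
have [pg1 pg2] := pg _ T01; have [cg1 cg2] := cg _ T01.
have V1 : V (p (g1 T)) by rewrite pg1.
have V2 : V (p (g2 T)) by rewrite pg2.
have [_ _ n1] := trV _ V1; have [_ _ n2] := trV _ V2.
have cHy : {for T, continuous (fun t => H (y, t))}.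
  exact: continuous_sectionr (cH _).
have : \forall t \near T, [/\ {in V, tr (g1 t) =1 tr (g1 T)},
   {in V, tr (g2 t) =1 tr (g2 T)} & V (H (y, t))].
  near=> t; split; near: t; [exact: cg1 n1 | exact: cg2 n2 |].
  by apply: cHy; exact: open_nbhs_nbhs.
move=> /nbhs_ballP[e /= e0 He]; exists e => // t u t01 u01 tT uT gt.
have [|T1 T2 VHt] := He t; first by rewrite /ball /= distrC.
have [|U1 U2 VHu] := He u; first by rewrite /ball /= distrC.
have [pt1 pt2] := pg _ t01; have [pu1 pu2] := pg _ u01.
have trK g v : V (p (g v)) -> p (g v) = H (y, v) -> tr (g v) (H (y, v)) = g v.
  by move=> Vg <-; have [] := trV _ Vg.
rewrite -(trK g1 u) ?pu1 // -(trK g2 u) ?pu2 //.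
by rewrite U1 ?U2 -?T1 -?T2 ?gt //; exact/mem_set.
Unshelve. all: by end_near. Qed.

Variable f : Y -> X.
Hypotheses (cf : continuous f) (pf : forall y, p (f y) = H (y, 0)).

(** The margin [d] on both sides of [0, t] lets continuity at the end times be ordinary continuity
    on [Y * R], without subspace topologies. *)
Definition local_lift (y : Y) (t : R) (N : set Y) (d : R) (g : Y * R -> X) :=
  [/\ open N, N y, 0 < d, forall x, N x -> g (x, 0) = f x &
      forall x u, N x -> - d < u < t + d ->
        p (g (x, u)) = H (x, u) /\ {for (x, u), continuous g}].

Lemma transport_tube (y : Y) (T : R) : exists (V : set B) (tr : X -> B -> X)
    (N : set Y) (e : R),
  [/\ open V, is_transport p V tr, open N, N y & 0 < e /\
    forall x u, N x -> `|u - T| < e -> V (H (x, u))].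
Proof.
have [V [tr [oV VT trV]]] := covp (H (y, T)).
have : nbhs (y, T) (H @^-1` V) by apply: cH; exact: open_nbhs_nbhs.
case=> -[A1 A2] /= [+ /nbhs_ballP[e /= e0 He]] sA.
rewrite nbhsE => -[N [oN Ny] NA1]; exists V, tr, N, e; split=> //; split=> //.
move=> x u Nx uT; apply: (sA (x, u)); split=> /=; first exact: NA1.
by apply: He; rewrite /ball /= distrC.
Qed.

(** A tube around (y, T) mapped by [H] into one evenly covered set carries a lift from time [t] to
    time [u]; the neighbourhood of [y] shrinks at each extension. *)
Lemma local_lift_exists (y : Y) : exists (N : set Y) (d : R) (g : Y * R -> X),
  local_lift y 1 N d g.
Proof.
apply: (segment_induction (fun t => exists N d g, local_lift y t N d g)).
  have [V [tr [N [e [oV trV oN Ny [e0 NV]]]]]] := transport_tube y 0.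
  have V0 x : N x -> V (p (f x)).
    by move=> Nx; rewrite pf; apply: NV; rewrite ?subrr ?normr0.
  exists N, e, (fun w => tr (f w.1) (H w)); split=> // x.
    by move=> /V0 Vx; rewrite /= -pf; have [] := trV _ Vx.
  move=> u Nx ue; have Vx := V0 _ Nx.
  have VH : V (H (x, u)) by apply: NV => //; rewrite ltr_norml; lra.
  split; first by have [_ /(_ _ VH)[]] := trV _ Vx.
  by apply: (@transport_continuous_at V tr f (x, u)) => //=; exact: cf.
move=> T T01.
have [V [tr [N [e [oV trV oN Ny [e0 NV]]]]]] := transport_tube y T.
exists e => // t u t01 u01; rewrite ltr_norml => tT; rewrite ltr_norml => uT.
move=> [M [d [g [oM My d0 g0 gH]]]].
(* Continuation of the lift: the point reached at time [t] is moved along [H] inside its sheet. *)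
pose k (w : Y * R) := tr (g (w.1, t)) (H w).
have gt x : M x -> p (g (x, t)) = H (x, t) /\ {for (x, t), continuous g}.
  by move=> Mx; apply: gH => //; lra.
have Vt x : N x -> M x -> V (p (g (x, t))).
  by move=> Nx Mx; rewrite (gt _ Mx).1; apply: NV => //; rewrite ltr_norml; lra.
have cgt x : M x -> {for x, continuous (fun x => g (x, t))}.
  by move=> Mx; exact: continuous_sectionl (gt _ Mx).2.
have kH x v : N x -> M x -> `|v - T| < e ->
    p (k (x, v)) = H (x, v) /\ {for (x, v), continuous k}.
  move=> Nx Mx vT; have Vx := Vt _ Nx Mx; have VH := NV _ _ Nx vT.
  split; first by have [_ /(_ _ VH)[]] := trV _ Vx.
  apply: (@transport_continuous_at V tr (fun x => g (x, t)) (x, v)) => //=.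
  exact: cgt.
(* Both maps lift [H] and stay in the sheet of [g (x, t)]. Agreement on a full neighbourhood makes
   the gluing at time [t] continuous. *)
have gk x : N x -> M x -> \forall w \near (x, t), g w = k w.
  move=> Nx Mx; have Vx := Vt _ Nx Mx; have [_ _ nx] := trV _ Vx.
  have n1 : \forall w \near (x, t), {in V, tr (g w) =1 tr (g (x, t))}.
    exact: (gt _ Mx).2 _ nx.
  have n2 : \forall w \near (x, t), {in V, tr (g (w.1, t)) =1 tr (g (x, t))}.
    apply: (near_fst (x, t) (fun z => {in V, tr (g (z, t)) =1 tr (g (x, t))})).
    exact: cgt nx.
  have VH : \forall w \near (x, t), V (H w).
    apply: cH; apply: open_nbhs_nbhs; split=> //; apply: NV => //.
    by rewrite ltr_norml; lra.
  have nM : \forall w \near (x, t), M w.1.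
    by apply: near_fst; exact: open_nbhs_nbhs.
  have nd : \forall w \near (x, t), - d < w.2 < t + d.
    apply: (near_snd (x, t) (fun u => - d < u < t + d)) => /=.
    apply/nbhs_ballP; exists d => //= v; rewrite /ball /= ltr_norml; lra.
  near=> w.
  have Vw : V (H w) by near: w.
  have [pw _] : p (g w) = H w /\ {for w, continuous g}.
    by rewrite [w]surjective_pairing; apply: gH; near: w.
  have [+ _ _] := trV (g w) (eq_ind_r V Vw pw); rewrite pw => {1}<-.
  by rewrite /k (near n1 w) // ?(near n2 w) //; exact/mem_set.
(* Times below [u] plus this margin stay below [T + e], where [k] lifts [H]; the bound [d] keeps
   negative times in the range of [g]. *)
exists (N `&` M), (Num.min d (T + e - u)),
  (fun w => if w.2 < t then g w else k w).
split=> //.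
- exact: openI.
- by rewrite lt_min d0 /=; lra.
- move=> x [Nx Mx] /=; case: ltP => [_|t0]; first exact: g0.
  have {t0} t0 : t = 0 by lra.
  move: (nbhs_singleton (gk x Nx Mx)); rewrite t0 => <-; exact: g0.
move=> x v [Nx Mx]; 
have : Num.min d (T + e - u) <= T + e - u by rewrite ge_min lexx orbT.
have : Num.min d (T + e - u) <= d by rewrite ge_min lexx.
move: (Num.min _ _) => m md mT vm.
case: (ltgtP v t) => vt.
- have [|pg cg] := gH x v Mx; first by lra.
  split; first by rewrite /= ?vt.
  apply: (@near_eq_continuous_at _ _ g); last exact: cg.
  have : \forall w \near (x, v), w.2 < t.
    by apply: (near_snd (x, v) (fun u => u < t)); exact: lt_nbhsl.
  by apply: filterS => w ->.
- have [|pk ck] := kH x v Nx Mx; first by rewrite ltr_norml; lra.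
  split; first by rewrite /= ?(ltNge v t) ?ltW.
  apply: (@near_eq_continuous_at _ _ k); last exact: ck.
  have : \forall w \near (x, v), t < w.2.
    by apply: (near_snd (x, v) (fun u => t < u)); exact: lt_nbhsr.
  by apply: filterS => w tw; rewrite ltNge ltW.
- subst v; have [|pk ck] := kH x t Nx Mx; first by rewrite ltr_norml; lra.
  split; first by rewrite /= ?ltxx.
  apply: (@near_eq_continuous_at _ _ k); last exact: ck; have := gk x Nx Mx.
  by apply: filterS => w ->; case: ifP.
Unshelve. all: by end_near. Qed.

(** Local lifts chosen at different points agree at time 1 by uniqueness of path lifting, so their
    diagonal is locally one of them and hence continuous. The last clause computes [F] from any
    lifted path. *)
Theorem homotopy_lift_end : exists F : Y -> X,
  [/\ continuous F, forall y, p (F y) = H (y, 1) &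
      forall y (g : R -> X),
        (forall t, 0 <= t <= 1 ->
          {for t, continuous g} /\ p (g t) = H (y, t)) ->
        g 0 = f y -> F y = g 1].
Proof.
have /choice[N /choice[d /choice[g lift]]] := local_lift_exists.
have gP y x : N y x -> (forall t, 0 <= t <= 1 ->
    {for t, continuous (fun t => g y (x, t))} /\ p (g y (x, t)) = H (x, t))
    /\ g y (x, 0) = f x.
  move=> Nx; have [_ _ d0 g0 gH] := lift y; split; last exact: g0.
  move=> t t01; have [|pg cg] := gH x t Nx; first by lra.
  by split=> //; exact: continuous_sectionr cg.
have Nyy y : N y y by have [] := lift y.
have FP y x (h : R -> X) : N y x -> (forall t, 0 <= t <= 1 ->
     {for t, continuous h} /\ p (h t) = H (x, t)) -> h 0 = f x ->
     g y (x, 1) = h 1.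
  move=> Nx hP h0; have [gP1 gP2] := gP y x Nx.
  apply: (path_lift_unique x (fun t => g y (x, t)) h); last by rewrite gP2 h0.
    by move=> t t01; split; [case: (gP1 t t01) | case: (hP t t01)].
  by move=> t t01; split; [case: (gP1 t t01) | case: (hP t t01)].
exists (fun y => g y (y, 1)); split=> [y|y|y h hP h0]; last exact: FP.
- have [oN Ny d0 _ gH] := lift y.
  have [|_ cg] := gH y 1 Ny; first by lra.
  apply: (@near_eq_continuous_at _ _ (fun x => g y (x, 1))); last first.
    exact: continuous_sectionl cg.
  have : \forall x \near y, N y x by exact: open_nbhs_nbhs.
  apply: filterS => x Nx; have [gP1 gP2] := gP x x (Nyy x).
  exact: (FP y x (fun t => g x (x, t))).
- have [gP1 _] := gP y y (Nyy y).
  by have [] := gP1 1 _; rewrite ?ler01 ?lexx.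
Qed.

End Lifting.

(** * Holomorphic maps in charts *)

(** Differentials depend only on germs. This is needed throughout because chart expressions of
    composites agree only near the base point. *)
Lemma near_eq_diff {K : numFieldType} {V W : normedModType K} (f g : V -> W)
    (x : V) :
  (\forall z \near x, f z = g z) -> differentiable f x ->
  differentiable g x /\ 'd g x = 'd f x :> (V -> W).
Proof.
move=> fg df.
have eg : g \o shift x = cst (g x) + 'd f x +o_ 0 id.
  apply/eqaddoP => e e0; have /eqaddoP/(_ _ e0) := diff_locally df.
  have : \forall h \near 0, f (h + x) = g (h + x).
    by move: fg; rewrite (near_shift 0) subr0.
  by apply: filterS2 => h /= fgh; rewrite /= !fctE /= fgh (nbhs_singleton fg).
have dg : 'd g x = 'd f x :> (V -> W).
  by apply: diff_unique => //; exact: diff_continuous.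
split=> //; apply/diff_locallyP; rewrite dg; split=> //.
exact: diff_continuous.
Qed.

Lemma row_mx_continuous {T : topologicalType} {m n : nat} :
  continuous (fun z : 'rV[T]_m * 'rV[T]_n => row_mx z.1 z.2).
Proof.
move=> [a b] A [P Pab sPA].
exists ([set u : 'rV[T]_m | forall i j, P i (lshift n j) (u i j)],
        [set u : 'rV[T]_n | forall i j, P i (rshift m j) (u i j)]).
  split; [exists (fun i j => P i (lshift n j)) |
    exists (fun i j => P i (rshift m j))]; move=> // i j.
    by have := Pab i (lshift n j); rewrite row_mxEl.
  by have := Pab i (rshift m j); rewrite row_mxEr.
move=> [u v] [/= Pu Pv]; apply: sPA => i j; rewrite mxE.
by case: split_ordP => k ->.
Qed.

(** This is the chart expression of the product of a map with the identity of the fibre, written as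
    a sum of two composites with linear block inclusions. *)
Lemma differentiable_block {K : numFieldType} {n m r : nat}
    (f : 'rV[K]_n -> 'rV[K]_m) (v : 'rV[K]_(n + r)) :
  differentiable f (lsubmx v) ->
  differentiable (fun w : 'rV[K]_(n + r) => row_mx (f (lsubmx w)) (rsubmx w)) v.
Proof.
move=> df.
pose L1 (a : 'rV[K]_m) : 'rV[K]_(m + r) := row_mx a 0.
pose L2 (b : 'rV[K]_r) : 'rV[K]_(m + r) := row_mx 0 b.
have lin1 : linear L1.
  by move=> k a b; rewrite /L1 scale_row_mx add_row_mx scaler0 addr0.
have lin2 : linear L2.
  by move=> k a b; rewrite /L2 scale_row_mx add_row_mx scaler0 addr0.
pose M1 := GRing.isLinear.Build _ _ _ _ _ lin1.
pose M2 := GRing.isLinear.Build _ _ _ _ _ lin2.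
pose F1 : {linear _ -> _} := HB.pack L1 M1.
pose F2 : {linear _ -> _} := HB.pack L2 M2.
have c1 : continuous F1.
  by move=> a; exact: (continuous_sectionl _ _ _ (row_mx_continuous (a, 0))).
have c2 : continuous F2.
  by move=> a; exact: (continuous_sectionr _ _ _ (row_mx_continuous (0, a))).
have -> : (fun w => row_mx (f (lsubmx w)) (rsubmx w)) =
    (F1 \o (f \o lsubmx)) \+ (F2 \o rsubmx).
  by apply/funext => w /=; rewrite /L1 /L2 add_row_mx addr0 add0r.
apply: differentiableD.
- apply: differentiable_comp; last exact: linear_differentiable.
  by apply: differentiable_comp => //; exact: differentiable_lsubmx.
- apply: differentiable_comp; last exact: linear_differentiable.
  exact: differentiable_rsubmx.
Qed.

Section Charts.
Context {R : realType} {T : topologicalType} (c : chart R T) (x : T).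
Hypotheses (chc : is_chart c) (cx : cdom c x).

Lemma chart_cinvK : cinv c (cmap c x) = x.
Proof. by have [_ _ cK _ _] := chc; apply: cK; exact/mem_set. Qed.

Lemma chart_cim : cim c (cmap c x).
Proof. by exists x. Qed.

Lemma chart_cinv_continuous : {for cmap c x, continuous (cinv c)}.
Proof.
by have [_ _ _ _ cc] := chc; apply: cc; apply/mem_set; exact: chart_cim.
Qed.

Lemma chart_near_cinv (A : set T) :
  nbhs x A -> \forall v \near cmap c x, A (cinv c v).
Proof. by rewrite -{1}chart_cinvK => /chart_cinv_continuous. Qed.

Lemma chart_near_cmapK : \forall v \near cmap c x, cmap c (cinv c v) = v.
Proof.
have [_ oc cK _ _] := chc.
have : \forall v \near cmap c x, cim c v.
  by apply: open_nbhs_nbhs; split=> //; exact: chart_cim.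
by apply: filterS => v [z cz <-]; rewrite cK //; exact/mem_set.
Qed.

End Charts.

(** Isolated so that the chart calculus also applies to [prod_space] and [lift_space] as bare
    charted spaces. *)
Definition is_atlas {R : realType} (M : charted_space R) : Prop :=
  (forall c : chart R M, atlas M c -> is_chart c) /\
  (forall x : M, atlas M (chart_at x) /\ cdom (chart_at x) x).

Lemma manifold_is_atlas {R : realType} (M : complex_manifold R) : is_atlas M.
Proof. by have [] := manifoldP M. Qed.

Definition holomorphic_at {R : realType} {M N : charted_space R} (f : M -> N)
    (x : M) : Prop :=
  {for x, continuous f} /\
  forall (c : chart R M) (d : chart R N), atlas M c -> atlas N d ->
    cdom c x -> cdom d (f x) ->
    differentiable (cmap d \o f \o cinv c) (cmap c x).

Section Holomorphic.
Context {R : realType} {M N K : charted_space R}.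
Hypotheses (aM : is_atlas M) (aN : is_atlas N) (aK : is_atlas K).

(** The intermediate chart [e] cancels only while [f] stays in its domain, which continuity ensures
    near [x]. *)
Lemma chart_comp_near (f : M -> N) (g : N -> K) (x : M)
    (c : chart R M) (d : chart R K) (e : chart R N) :
  atlas M c -> atlas N e -> cdom c x -> cdom e (f x) ->
  {for x, continuous f} ->
  \forall v \near cmap c x,
    ((cmap d \o g \o cinv e) \o (cmap e \o f \o cinv c)) v =
    (cmap d \o (g \o f) \o cinv c) v.
Proof.
move=> /aM.1 hc /aN.1 he cx efx cf.
have [oe _ eK _ _] := he.
have : \forall v \near cmap c x, cdom e (f (cinv c v)).
  apply: (chart_near_cinv c x hc cx (f @^-1` cdom e)).
  by apply: cf; exact: open_nbhs_nbhs.
by apply: filterS => v ev /=; rewrite eK //; exact/mem_set.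
Qed.

Lemma holomorphic_at_comp (f : M -> N) (g : N -> K) (x : M) :
  holomorphic_at f x -> holomorphic_at g (f x) -> holomorphic_at (g \o f) x.
Proof.
move=> [cf df] [cg dg]; split; first exact: continuous_comp.
move=> c d ac ad cx dgfx; have [ae efx] := aN.2 (f x).
have nE := chart_comp_near f g x c d _ ac ae cx efx cf.
refine (near_eq_diff _ _ _ nE _).1.
apply: differentiable_comp; first exact: df.
by rewrite /= (chart_cinvK _ _ (aM.1 _ ac) cx); exact: dg.
Qed.

Lemma near_eq_holomorphic_at (f g : M -> N) (x : M) :
  (\forall z \near x, f z = g z) -> holomorphic_at f x -> holomorphic_at g x.
Proof.
move=> fg [cf df]; split; first exact: near_eq_continuous_at cf.
move=> c d ac ad cx; rewrite -(nbhs_singleton fg) => dfx.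
have nE : \forall v \near cmap c x,
    (cmap d \o f \o cinv c) v = (cmap d \o g \o cinv c) v.
  have := chart_near_cinv c x (aM.1 _ ac) cx _ fg.
  by apply: filterS => v /= ->.
refine (near_eq_diff _ _ _ nE _).1; exact: df.
Qed.

(** Chain rule. The image points enter through equations, so it applies where these are proved but
    not definitional, as for a lifted spray at a zero vector. *)
Lemma mdiff_comp (f : M -> N) (g : N -> K) (x : M) (y : N) (z : K)
    (v : tangent x) :
  y = f x -> z = g y -> holomorphic_at f x -> holomorphic_at g y ->
  mdiff (g \o f) x z v = mdiff g y z (mdiff f x y v).
Proof.
move=> -> -> [cf df] [cg dg].
have [ac cx] := aM.2 x; have [ae efx] := aN.2 (f x).
have [ad dgx] := aK.2 (g (f x)).
have xE := chart_cinvK _ _ (aM.1 _ ac) cx.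
have dF := df _ _ ac ae cx efx.
have dG : differentiable
    (cmap (chart_at (g (f x))) \o g \o cinv (chart_at (f x)))
    ((cmap (chart_at (f x)) \o f \o cinv (chart_at x)) (cmap (chart_at x) x)).
  by rewrite /= xE; exact: dg.
have nE := chart_comp_near f g x _ (chart_at (g (f x))) _ ac ae cx efx cf.
have [_ dE] := near_eq_diff _ _ _ nE (differentiable_comp dF dG).
have := congr1 (@^~ v) (etrans dE (diff_comp dF dG)).
rewrite /= xE; exact.
Qed.

End Holomorphic.

Lemma mdiff_near_id {R : realType} {M : charted_space R} (f : M -> M) (x : M)
    (v : tangent x) :
  is_atlas M -> (\forall z \near x, f z = z) -> mdiff f x x v = v.
Proof.
move=> aM fz; have [ac cx] := aM.2 x; have hc := aM.1 _ ac.
have nE : \forall w \near cmap (chart_at x) x,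
    id w = (cmap (chart_at x) \o f \o cinv (chart_at x)) w.
  apply: filterS2 (chart_near_cinv _ x hc cx _ fz) (chart_near_cmapK _ x hc cx).
  by move=> w /= -> ->.
have di := is_diff_id (cmap (chart_at x) x).
have [_ dE] := near_eq_diff _ _ _ nE (@ex_diff _ _ _ _ _ _ _ di).
have := congr1 (@^~ v) (etrans dE (@diff_val _ _ _ _ _ _ _ di)).
by rewrite /mdiff.
Qed.

Section ProductSpace.
Context {R : realType} {M N : charted_space R}.
Implicit Types r : nat.

Lemma prod_space_is_atlas r : is_atlas M -> is_atlas (prod_space M r).
Proof.
move=> aM; split=> [_ [c ac <-]|[x v]]; last first.
  by have [ac cx] := aM.2 x; split=> //=; exists (chart_at x).
have [oc ic cK cc ci] := aM.1 _ ac.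
have cimE : cim (prod_chart r c) = lsubmx @^-1` cim c.
  apply/seteqP; split=> [_ [[z u] /= cz <-]|w [z cz zw]].
    by exists z => //; rewrite row_mxKl.
  by exists (z, rsubmx w) => //=; rewrite zw hsubmxK.
split=> /=.
- by apply: (@open_comp _ _ fst) => // z _; exact: cvg_fst.
- by rewrite cimE; apply: open_comp => // z _; exact: continuous_lsubmx.
- move=> [z u] /set_mem /= cz; rewrite row_mxKl row_mxKr cK //.
  exact/mem_set.
- move=> [z u] /set_mem /= cz.
  apply: (@continuous_comp _ _ _ (fun z => (cmap c z.1, z.2))
    (fun z => row_mx z.1 z.2)); last exact: row_mx_continuous.
  apply: continuous_pair; last exact: cvg_snd.
  apply: (@continuous_comp _ _ _ fst (cmap c)); first exact: cvg_fst.
  by apply: cc; exact/mem_set.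
- move=> w /set_mem; rewrite cimE => cw.
  apply: continuous_pair; last exact: continuous_rsubmx.
  apply: (@continuous_comp _ _ _ lsubmx (cinv c)).
    exact: continuous_lsubmx.
  by apply: ci; exact/mem_set.
Qed.

Lemma holomorphic_at_prod r (f : M -> N) (z : prod_space M r) :
  holomorphic_at f z.1 ->
  @holomorphic_at R (prod_space M r) (prod_space N r)
    (fun w => (f w.1, w.2)) z.
Proof.
move=> [cf df]; split.
  apply: continuous_pair; last exact: cvg_snd.
  by apply: (@continuous_comp _ _ _ fst f); first exact: cvg_fst.
move=> _ _ [c ac <-] [d ad <-] /= cz dz.
apply: (@differentiable_block _ _ _ _ (cmap d \o f \o cinv c)).
by rewrite row_mxKl; exact: df.
Qed.

End ProductSpace.

(** * Complex structures lifted along local homeomorphisms *)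

Definition open_map {T U : topologicalType} (f : T -> U) : Prop :=
  forall A : set T, open A -> open (f @` A).

Definition injective_nbhs {T U : topologicalType} (f : T -> U) (x : T) :
    set (set T) :=
  [set W | [/\ open W, W x & {in W &, injective f}]].

Definition local_homeomorphism {T U : topologicalType} (f : T -> U) : Prop :=
  [/\ continuous f, open_map f & forall x, injective_nbhs f x !=set0].

(* The default [x0] makes the inverse total; it is irrelevant on the image. *)
Definition lift_chart {R : realType} {X : topologicalType} {M : Type}
    (q : X -> M) (W : set X) (x0 : X) (c : chart R M) : chart R X :=
  Chart (cdim c) (W `&` q @^-1` cdom c) (cmap c \o q)
    (fun v => xget x0 (W `&` q @^-1` [set cinv c v])).

(* The preferred chart at [x] is the preferred chart at [q x] composed with [q],
   so [tangent x] and [tangent (q x)] are convertible. *)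
Definition lift_space {R : realType} {X : topologicalType}
    {M : charted_space R} (q : X -> M) : charted_space R :=
  @ChartedSpace R X
    [set d | exists W x0 c, [/\ open W, {in W &, injective q}, atlas M c &
       d = lift_chart q W x0 c]]
    (fun x => lift_chart q (xget setT (injective_nbhs q x)) x (chart_at (q x))).

Section LiftSpace.
Context {R : realType} {X : topologicalType} {M : charted_space R}.
Variable q : X -> M.
Hypotheses (aM : is_atlas M) (lq : local_homeomorphism q).

Lemma lift_cinvE (W : set X) (x0 x : X) (c : chart R M) v :
  {in W &, injective q} -> W x -> q x = cinv c v ->
  cinv (lift_chart q W x0 c) v = x.
Proof.
move=> injW Wx qx /=; case: xgetP => [y _ [Wy qy]|/(_ x)[]//].
by apply: injW; rewrite ?inE // qx.
Qed.

Lemma lift_chart_is_chart (W : set X) (x0 : X) (c : chart R M) :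
  open W -> {in W &, injective q} -> is_chart c ->
  is_chart (lift_chart q W x0 c).
Proof.
move=> oW injW hc; have [oc ic cK cc ci] := hc; have [cq oq _] := lq.
have odom : open (W `&` q @^-1` cdom c).
  by apply: openI => //; apply: open_comp => // z _; exact: cq.
split=> //.
- have -> : cim (lift_chart q W x0 c) =
      cim c `&` cinv c @^-1` (q @` (W `&` q @^-1` cdom c)).
    apply/seteqP; split=> [_ [x [Wx cx] <-]|v [[y cy yv] [x [Wx cx] qx]]].
      by split; [exists (q x) | exists x => //=; rewrite cK //; exact/mem_set].
    exists x => //=; rewrite qx -yv cK //; exact/mem_set.
  rewrite openE => v [cv qv]; apply: filterI; first exact: open_nbhs_nbhs.
  by apply: ci; [exact/mem_set | apply: open_nbhs_nbhs; split=> //; exact: oq].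
- move=> x /set_mem[Wx cx]; apply: lift_cinvE => //=.
  by rewrite cK //; exact/mem_set.
- move=> x /set_mem[Wx cx].
  apply: (@continuous_comp _ _ _ q (cmap c) x (cq x)).
  by apply: cc; exact/mem_set.
- move=> _ /set_mem[x [Wx cx] <-] A; set v := cmap _ x.
  have vE : cinv c v = q x by rewrite /v /= cK //; exact/mem_set.
  rewrite (lift_cinvE W x0 x c v) // nbhsE => -[B [oB Bx] BA].
  have nB : nbhs (cinv c v) (q @` (W `&` B)).
    apply: open_nbhs_nbhs; split; first by apply: oq; exact: openI.
    by rewrite vE; exists x.
  have cv : v \in cim c by apply/mem_set; exists (q x).
  change (nbhs v (cinv (lift_chart q W x0 c) @^-1` A)).
  apply: (@filterS _ _ (nbhs_filter (cmap c (q x))) _ _ _ (ci v cv _ nB)).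
  move=> w [y [Wy By] qy].
  change (A (cinv (lift_chart q W x0 c) w)).
  by rewrite (lift_cinvE W x0 y c w) //; exact: BA.
Qed.

Lemma lift_chart_near (x : X) (W : set X) (x0 : X) (c : chart R M) :
  open W -> {in W &, injective q} -> is_chart c -> W x -> cdom c (q x) ->
  \forall v \near cmap c (q x), q (cinv (lift_chart q W x0 c) v) = cinv c v.
Proof.
move=> oW injW hc Wx cx; have [cq oq _] := lq.
have : nbhs (q x) (q @` W).
  by apply: open_nbhs_nbhs; split; [exact: oq | exists x].
move=> /(chart_near_cinv _ _ hc cx); apply: filterS => v [y Wy qy].
by rewrite (lift_cinvE W x0 y c v).
Qed.

Lemma lift_space_is_atlas : is_atlas (lift_space q).
Proof.
split=> [_ [W [x0 [c [oW injW ac ->]]]]|x].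
  by apply: lift_chart_is_chart => //; exact: aM.1.
have [_ _ /(_ x) [W0 W0P]] := lq.
have [oW Wx injW] := xgetI setT W0P.
have [ac cx] := aM.2 (q x); split=> //.
by exists (xget setT (injective_nbhs q x)), x, (chart_at (q x)).
Qed.

(** Near the point, [q] reads in a lifted chart of [c] and in [d] as the transition map from [c] to
    [d]. *)
Lemma lift_map_holomorphic_at (x : X) :
  (forall (c d : chart R M) (x : M), atlas M c -> atlas M d ->
        cdom c x -> cdom d x ->
        differentiable (cmap d \o cinv c) (cmap c x)) ->
  @holomorphic_at R (lift_space q) M q x.
Proof.
move=> hM; split; first by have [cq _ _] := lq; exact: cq.
move=> _ d [W [x0 [c [oW injW ac ->]]]] ad [Wx cx] dx.
have nE : \forall v \near cmap c (q x),
   (cmap d \o cinv c) v = (cmap d \o q \o cinv (lift_chart q W x0 c)) v.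
  have := lift_chart_near x W x0 c oW injW (aM.1 _ ac) Wx cx.
  by apply: filterS => v qv; rewrite /comp qv.
refine (near_eq_diff _ _ _ nE _).1; exact: hM.
Qed.

(** A lifted chart starts with [q], so the chart expressions of [k] are literally those of
    [q \o k]. *)
Lemma holomorphic_at_lift {N : charted_space R} (k : N -> lift_space q)
    (x : N) :
  {for x, continuous k} -> holomorphic_at (q \o k) x -> holomorphic_at k x.
Proof.
move=> ck [_ dk]; split=> // c _ ac [W [x0 [d [oW injW ad ->]]]] cx [Wk dkx].
exact: dk.
Qed.

(** In the preferred charts [q] is the identity near [x]; the vector [v] is read in both tangent
    spaces by conversion. *)
Lemma mdiff_lift {N : charted_space R} (g : M -> N) (x : X) (z : N)
    (v : @tangent R (lift_space q) x) :
  z = g (q x) -> is_atlas N -> holomorphic_at g (q x) ->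
  @mdiff R (lift_space q) N (g \o q) x z v = mdiff g (q x) z v.
Proof.
move=> -> aN [cg dg]; have [ac cx] := aM.2 (q x).
have [ad dx] := aN.2 (g (q x)).
have [_ _ /(_ x) [W0 W0P]] := lq.
have [oW Wx injW] := xgetI setT W0P.
have nq := lift_chart_near x _ x _ oW injW (aM.1 _ ac) Wx cx.
have nE : \forall v \near cmap (chart_at (q x)) (q x),
   (cmap (chart_at (g (q x))) \o g \o cinv (chart_at (q x))) v =
   (cmap (chart_at (g (q x))) \o (g \o q) \o
     cinv (@chart_at _ (lift_space q) x)) v.
  by apply: filterS nq => w qw; rewrite /comp qw.
have [_ dE] := near_eq_diff _ _ _ nE (dg _ _ ac ad cx dx).
by have := congr1 (@^~ v) dE; rewrite /mdiff.
Qed.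

(** Transition maps between lifted charts are chart expressions of [q], hence differentiable. *)
Lemma lift_space_is_manifold :
  is_complex_manifold M -> hausdorff_space X -> @second_countable X ->
  is_complex_manifold (lift_space q).
Proof.
move=> [_ _ hM _ _] hX sX; have [aX bX] := lift_space_is_atlas.
split=> // c d x ac + cx.
move=> [W [x0 [d' [oW injW ad ->]]]] [Wx dx].
by have [_ dq] := lift_map_holomorphic_at x hM; exact: dq.
Qed.

End LiftSpace.

(** * Fibre products *)

Definition is_local_section {X B : topologicalType} (p : X -> B) (S : set X)
    (V : set B) (s : B -> X) : Prop :=
  [/\ open S, open V, forall x, S x -> V (p x) /\ s (p x) = x &
      forall y, V y -> [/\ S (s y), p (s y) = y & {for y, continuous s}]].

(** Serves the Hausdorff property, which is phrased by cluster points of neighbourhood filters. *)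
Lemma cluster_continuous {T U : topologicalType} (g : T -> U) (a b : T) :
  continuous g -> cluster (nbhs a) b -> cluster (nbhs (g a)) (g b).
Proof.
move=> cg ab A C /cg gA /cg gC; have [z [Az Cz]] := ab _ _ gA gC.
by exists (g z).
Qed.

Section FiberProduct.
Context {X B E : topologicalType}.
Variables (p : X -> B) (r : E -> B).

Definition fiber_product : Type := set_type [set z : X * E | p z.1 = r z.2].
HB.instance Definition _ := Topological.on fiber_product.

Definition fp_pair (x : X) (e : E) (h : p x = r e) : fiber_product :=
  SigSub (mem_set (h : [set z : X * E | p z.1 = r z.2] (x, e))).

Definition fp_fst (z : fiber_product) : X := (val z).1.
Definition fp_snd (z : fiber_product) : E := (val z).2.

Lemma fp_eq (z : fiber_product) : p (fp_fst z) = r (fp_snd z).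
Proof. exact: (set_valP z). Qed.

Lemma fp_inj (z w : fiber_product) :
  fp_fst z = fp_fst w -> fp_snd z = fp_snd w -> z = w.
Proof.
move=> h1 h2; apply: val_inj; rewrite [LHS]surjective_pairing.
by rewrite [RHS]surjective_pairing; congr pair.
Qed.

Lemma fp_val_continuous : continuous (val : fiber_product -> X * E).
Proof. exact: initial_continuous. Qed.

Lemma fp_fst_continuous : continuous fp_fst.
Proof.
move=> z; apply: (@continuous_comp _ _ _ _ fst z (fp_val_continuous z)).
exact: cvg_fst.
Qed.

Lemma fp_snd_continuous : continuous fp_snd.
Proof.
move=> z; apply: (@continuous_comp _ _ _ _ snd z (fp_val_continuous z)).
exact: cvg_snd.
Qed.

Lemma fp_continuous_at {T : topologicalType} (f : T -> fiber_product) (t : T) :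
  {for t, continuous (fp_fst \o f)} -> {for t, continuous (fp_snd \o f)} ->
  {for t, continuous f}.
Proof.
move=> c1 c2 A [_ /= [[U oU <-] Uft] UA].
have nU := continuous_pair _ _ _ c1 c2 U.
have fE : (fp_fst (f t), fp_snd (f t)) = val (f t).
  by rewrite [RHS]surjective_pairing.
have {}nU : nbhs t (fun s => U (fp_fst (f s), fp_snd (f s))).
  by apply: nU; apply: open_nbhs_nbhs; split=> //=; rewrite fE.
change (nbhs t (f @^-1` A)); apply: filterS nU => s Us; apply: UA => /=.
by rewrite set_valE [val _]surjective_pairing.
Qed.

Lemma fp_hausdorff :
  hausdorff_space X -> hausdorff_space E -> hausdorff_space fiber_product.
Proof.
move=> hX hE a b ab; apply: fp_inj.
  by apply: hX; apply: cluster_continuous ab; exact: fp_fst_continuous.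
by apply: hE; apply: cluster_continuous ab; exact: fp_snd_continuous.
Qed.

Lemma fp_second_countable :
  @second_countable X -> @second_countable E ->
  @second_countable fiber_product.
Proof.
move=> [B1 cB1 [oB1 bB1]] [B2 cB2 [oB2 bB2]].
pose F (PQ : set X * set E) := fp_fst @^-1` PQ.1 `&` fp_snd @^-1` PQ.2.
exists (F @` (B1 `*` B2)).
  by apply: sub_countable (card_image_le _ _) _; exact: countableX.
split=> [_ [[P Q] [/= BP BQ] <-]|z A].
  apply: openI; apply: open_comp => [w _|].
  - exact: fp_fst_continuous.
  - exact: oB1.
  - exact: fp_snd_continuous.
  - exact: oB2.
move=> [_ /= [[U oU <-] Uz] UA].
have [[P Q] /= [nP nQ] PQU] : nbhs (val z) U by exact: open_nbhs_nbhs.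
have [P' [BP' P'z] P'P] := bB1 _ _ nP; have [Q' [BQ' Q'z] Q'Q] := bB2 _ _ nQ.
exists (F (P', Q')); first by split=> //; exists (P', Q').
by move=> w [/P'P Pw /Q'Q Qw]; apply: UA; apply: PQU.
Qed.

(** A local section [s] of [p] gives the local inverse e |-> (s (r e), e), whence openness. Over [S]
    the component in [X] is determined by its image under [p], whence injectivity. *)
Lemma fp_local_homeomorphism :
  continuous r ->
  (forall x, exists S V s, S x /\ is_local_section p S V s) ->
  local_homeomorphism fp_snd.
Proof.
move=> cr loc; split; first exact: fp_snd_continuous.
- move=> A; rewrite openE => oA; rewrite openE => _ [z Az <-].
  have [S [V [s [Sz [oS oV pS sV]]]]] := loc (fp_fst z).
  have [Vz sz] := pS _ Sz.
  have [_ /= [[U oU <-] Uz] UA] := oA z Az.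
  have Vr : V (r (fp_snd z)) by rewrite -fp_eq.
  have : nbhs (fp_snd z) ((fun e => (s (r e), e)) @^-1` U).
    apply: continuous_pair.
    - apply: (@continuous_comp _ _ _ r s _ (cr _)).
      by have [] := sV _ Vr.
    - by [].
    - rewrite -fp_eq sz; apply: open_nbhs_nbhs; split=> //.
      by move: Uz; rewrite /= set_valE [val _]surjective_pairing.
  have : nbhs (fp_snd z) (r @^-1` V) by apply: cr; exact: open_nbhs_nbhs.
  apply: filterS2 => e Ve Ue; have [_ pe _] := sV _ Ve.
  by exists (fp_pair (s (r e)) e pe) => //; apply: UA.
- move=> z; have [S [V [s [Sz [oS oV pS sV]]]]] := loc (fp_fst z).
  exists (fp_fst @^-1` S); split=> //.
    by apply: open_comp => // w _; exact: fp_fst_continuous.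
  move=> a b /set_mem Sa /set_mem Sb ab; apply: fp_inj => //.
  by rewrite -(pS _ Sa).2 -(pS _ Sb).2 !fp_eq ab.
Qed.

End FiberProduct.

(** * Sheets and local sections of a holomorphic covering *)

Lemma biholomorphic_local_section {R : realType} {X Y : charted_space R}
    (p : X -> Y) (S : set X) (V : set Y) :
  biholomorphic_on S V p -> exists s : Y -> X,
    is_local_section p S V s /\ forall y, V y -> holomorphic_at s y.
Proof.
move=> [oS oV hp pSV [s [hs sVS pK sK]]]; exists s; split; last exact: hs.
split=> // [x Sx|y Vy].
  by split; [apply: pSV; exists x | rewrite pK //; exact/mem_set].
split; [by apply: sVS; exists y | by rewrite sK //; exact/mem_set |].
by have [] := hs y Vy.
Qed.

Section Covering.
Context {R : realType} {Y' Y : complex_manifold R}.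
Variable p : Y' -> Y.
Hypothesis hp : holomorphic_covering p.

Lemma covering_local_section (x : Y') : exists S V s,
  [/\ S x, is_local_section p S V s & forall y, V y -> holomorphic_at s y].
Proof.
have [V [oV Vpx [F [FV _ Fbi]]]] := hp.2 (p x).
have : (p @^-1` V) x by [].
rewrite FV => -[S FS Sx].
have [s [sS hs]] := biholomorphic_local_section p S V (Fbi S FS).
by exists S, V, s.
Qed.

Lemma covering_topological : topological_covering p.
Proof.
move=> y; have [V [oV Vy [F [FV tF Fbi]]]] := hp.2 y.
have : forall x : Y', exists h : Y -> Y', V (p x) ->
    exists2 S, F S & S x /\ is_local_section p S V h.
  move=> x; have [Vpx|nV] := pselect (V (p x)); last by exists (fun=> x).
  have : (p @^-1` V) x by [].
  rewrite FV => -[S FS Sx].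
  have [s [sS hs]] := biholomorphic_local_section p S V (Fbi S FS).
  by exists s => _; exists S.
move=> /choice[tr trP]; exists V, tr; split=> // x Vx.
have [S FS [Sx [oS _ pS hS]]] := trP x Vx.
(* Sections were chosen point by point; the sheet chosen for [x'] meets [S], so disjointness makes
   it [S], and injectivity of [p] on [S] identifies the sections over [V]. *)
have trS x' : S x' -> {in V, tr x' =1 tr x}.
  move=> Sx' v /set_mem Vv.
  have [S' FS' [Sx'' [_ _ _ hS']]] := trP x' (pS _ Sx').1.
  have SS' : S' = S by apply: tF => //; exists x'.
  rewrite SS' in hS'; have [Sa pa _] := hS' v Vv; have [Sb pb _] := hS v Vv.
  by rewrite -(pS _ Sa).2 -[RHS](pS _ Sb).2 pa pb.
split; first exact: (pS x Sx).2.
- move=> v Vv; have [Sv pv cv] := hS v Vv; split=> //; exact: trS.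
- have : nbhs x S by exact: open_nbhs_nbhs.
  by apply: filterS => x'; exact: trS.
Qed.

End Covering.

(** * Pullback of a vector bundle along a covering *)

Lemma scale_rV_continuous {K : numFieldType} {r : nat} :
  continuous (fun z : K * 'rV[K]_r => z.1 *: z.2).
Proof. exact: (@scale_continuous K 'rV[K]_r). Qed.

Section VectorBundle.
Context {R : realType} {Y : complex_manifold R} (E : vector_bundle Y).

Lemma bundle_proj_continuous : continuous (proj E).
Proof.
have [hE _ _ _ _] := vector_bundleP E.
by move=> e; have [] := hE e I.
Qed.

Lemma bundle_proj_zero (y : Y) : proj E (vzero E y) = y.
Proof. by have [_ + _ _ _] := vector_bundleP E. Qed.

Lemma bundle_proj_scale (a : cplx R) (e : E) : proj E (vscale a e) = proj E e.
Proof. by have [_ _ _ + _] := vector_bundleP E. Qed.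

(** The bundle operations are governed only through trivializations, so identities between them are
    checked on fibre coordinates. *)
Lemma trivialization_inj (U : set Y) r (h : E -> prod_space Y r) (e e' : E) :
  is_trivialization E U h -> U (proj E e) -> proj E e = proj E e' ->
  (h e).2 = (h e').2 -> e = e'.
Proof.
move=> [[_ _ _ _ [k [_ _ hK _]]] h1 _ _ _] Ue ee' hh.
have Ue' : U (proj E e') by rewrite -ee'.
rewrite -(hK e (mem_set Ue)) -(hK e' (mem_set Ue')); congr k.
by rewrite [LHS]surjective_pairing [RHS]surjective_pairing hh !h1 ?ee'.
Qed.

Lemma bundle_scale0 (e : E) : vscale 0 e = vzero E (proj E e).
Proof.
have [_ p0 _ ps /(_ (proj E e))[U [r [h [oU Ue tU]]]]] := vector_bundleP E.
have [_ _ h0 _ hs] := tU.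
apply: (trivialization_inj U r h) => //; rewrite ?ps ?p0 //.
by rewrite hs // h0 // scale0r.
Qed.

Lemma bundle_scale1 (e : E) : vscale 1 e = e.
Proof.
have [_ p0 _ ps /(_ (proj E e))[U [r [h [oU Ue tU]]]]] := vector_bundleP E.
have [_ _ _ _ hs] := tU.
apply: (trivialization_inj U r h) => //; rewrite ?ps //.
by rewrite hs // scale1r.
Qed.

Lemma bundle_scale_zero (a : cplx R) (y : Y) :
  vscale a (vzero E y) = vzero E y.
Proof.
have [_ p0 _ ps /(_ y)[U [r [h [oU Uy tU]]]]] := vector_bundleP E.
have [_ _ h0 _ hs] := tU.
apply: (trivialization_inj U r h) => //; rewrite ?ps ?p0 //.
by rewrite hs ?p0 // h0 // scaler0.
Qed.

(** In a trivialization with inverse [k], scaling is (b, e) |-> k (proj e, b h(e)), with h(e) the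
    fibre coordinate. *)
Lemma bundle_scale_continuous :
  continuous (fun w : cplx R * E => vscale w.1 w.2).
Proof.
move=> [a e].
have [_ p0 _ ps /(_ (proj E e))[U [r [h [oU Ue tU]]]]] := vector_bundleP E.
have [[oUE oUY hh hU [k [hk _ hK kK]]] h1 _ _ hs] := tU.
have Uw : \forall w \near (a, e), U (proj E w.2).
  apply: (near_snd (a, e) (fun e => U (proj E e))).
  by apply: bundle_proj_continuous; exact: open_nbhs_nbhs.
have kE b e' : U (proj E e') -> k (proj E e', b *: (h e').2) = vscale b e'.
  move=> Ue'; rewrite -[RHS]hK; last by apply/mem_set; rewrite /= ps.
  congr k; rewrite [RHS]surjective_pairing h1 ?ps //.
  by rewrite hs.
pose m (w : cplx R * E) : prod_space Y r := (proj E w.2, w.1 *: (h w.2).2).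
suff ckm : {for (a, e), continuous (k \o m)}.
  have nE : \forall w \near (a, e), (k \o m) w = vscale w.1 w.2.
    by apply: filterS Uw => -[b e'] /= Ue'; exact: kE.
  exact: near_eq_continuous_at nE ckm.
have snd_c : {for (a, e), continuous (snd : cplx R * E -> E)} by exact: cvg_snd.
apply: (@continuous_comp _ _ _ m k).
  apply: continuous_pair.
    exact: (@continuous_comp _ _ _ snd (proj E) (a, e) snd_c
      (bundle_proj_continuous _)).
  have ch : {for (a, e), continuous (fun w : cplx R * E => (h w.2).2)}.
    apply: (@continuous_comp _ _ _ (fun w : cplx R * E => h w.2) snd).
      apply: (@continuous_comp _ _ _ snd h (a, e) snd_c).
      by have [] := hh e Ue.
    exact: cvg_snd.
  apply: (@continuous_comp _ _ _ (fun w : cplx R * E => (w.1, (h w.2).2))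
    (fun z => z.1 *: z.2)); last exact: scale_rV_continuous.
  by apply: continuous_pair; first exact: cvg_fst.
by have [] := hk (proj E e, a *: (h e).2) Ue.
Qed.

End VectorBundle.

Section PullbackBundle.
Context {R : realType} {Y' Y : complex_manifold R}.
Variables (p : Y' -> Y) (hp : holomorphic_covering p) (E : vector_bundle Y).

Definition pullback : topologicalType := fiber_product p (proj E).

Definition pullback_map : pullback -> E := fp_snd p (proj E).

Lemma pullback_local_homeomorphism : local_homeomorphism pullback_map.
Proof.
apply: fp_local_homeomorphism; first exact: bundle_proj_continuous.
move=> x; have [S [V [s [Sx sS _]]]] := covering_local_section p hp x.
by exists S, V, s.
Qed.

Lemma pullback_is_manifold : is_complex_manifold (lift_space pullback_map).
Proof.
apply: lift_space_is_manifold (manifoldP E) _ _.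
- exact: manifold_is_atlas.
- exact: pullback_local_homeomorphism.
- have [_ _ _ hY _] := manifoldP Y'; have [_ _ _ hE _] := manifoldP E.
  exact: fp_hausdorff.
- have [_ _ _ _ sY] := manifoldP Y'; have [_ _ _ _ sE] := manifoldP E.
  exact: fp_second_countable.
Qed.

Definition pullback_manifold : complex_manifold R :=
  ComplexManifold _ pullback_is_manifold.

Lemma pullback_zero_subproof (y : Y') : p y = proj E (vzero E (p y)).
Proof. by rewrite bundle_proj_zero. Qed.

Lemma pullback_scale_subproof (a : cplx R) (z : pullback) :
  p (fp_fst p (proj E) z) = proj E (vscale a (pullback_map z)).
Proof. by rewrite bundle_proj_scale; exact: fp_eq. Qed.

(** For [z] and [w] in different fibres the pair may leave the fibre product; the default [z] then
    makes the operation total. Scaling preserves the base point, so it is given directly by a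
    pair. *)
Definition pullback_add (z w : pullback) : pullback :=
  insubd (z : {x | x \in [set z : Y' * E | p z.1 = proj E z.2]})
    (fp_fst p (proj E) z, vadd (pullback_map z) (pullback_map w)).

Definition pullback_data : bundle_data Y' :=
  @BundleData R Y' pullback_manifold (fp_fst p (proj E))
    (fun y => fp_pair p (proj E) y (vzero E (p y)) (pullback_zero_subproof y))
    pullback_add
    (fun a z => fp_pair p (proj E) _ _ (pullback_scale_subproof a z)).

End PullbackBundle.

Section PullbackVectorBundle.
Context {R : realType} {Y' Y : complex_manifold R}.
Variables (p : Y' -> Y) (hp : holomorphic_covering p) (E : vector_bundle Y).

Let P : bundle_data Y' := pullback_data p hp E.
Let q : P -> E := pullback_map p E.

Lemma pullback_eq (z : P) : proj E (q z) = p (proj P z).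
Proof. by apply/esym; exact: fp_eq. Qed.

Lemma pullback_val_add (z w : P) : proj P z = proj P w ->
  proj P (vadd z w) = proj P z /\ q (vadd z w) = vadd (q z) (q w).
Proof.
move=> zw; have [_ _ pa _ _] := vector_bundleP E.
have h : (proj P z, vadd (q z) (q w)) \in [set z : Y' * E | p z.1 = proj E z.2].
  have qq : proj E (q z) = proj E (q w) by rewrite !pullback_eq zw.
  by apply/mem_set; exact: (etrans (esym (pullback_eq z)) (esym (pa _ _ qq))).
have vE : val (pullback_add p E z w) = (proj P z, vadd (q z) (q w)).
  exact: (insubdK _ h).
by split; [exact: (congr1 fst vE) | exact: (congr1 snd vE)].
Qed.

Lemma pullback_map_holomorphic_at (z : P) : holomorphic_at q z.
Proof.
have [_ _ hE _ _] := manifoldP E.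
apply: lift_map_holomorphic_at => //; first exact: manifold_is_atlas.
exact: pullback_local_homeomorphism.
Qed.

Lemma holomorphic_at_pullback {N : charted_space R} (k : N -> P) (x : N) :
  {for x, continuous (proj P \o k)} -> holomorphic_at (q \o k) x ->
  holomorphic_at k x.
Proof.
move=> c1 hk; apply: holomorphic_at_lift => //.
by apply: fp_continuous_at => //; case: hk.
Qed.

(** By continuity [f] stays near [z] in one sheet, where it equals [g] followed by the holomorphic
    section of that sheet. *)
Lemma holomorphic_at_section (Z : complex_manifold R) (f : Z -> Y') (g : Z -> Y)
    (z : Z) :
  {for z, continuous f} -> (forall w, p (f w) = g w) -> holomorphic_at g z ->
  holomorphic_at f z.
Proof.
move=> cf pfg hg.
have [S [V [s [Sz [oS _ pS _] hs]]]] := covering_local_section p hp (f z).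
have nE : \forall w \near z, (s \o g) w = f w.
  have : nbhs z (f @^-1` S) by apply: cf; exact: open_nbhs_nbhs.
  by apply: filterS => w Sw; rewrite /= -pfg (pS _ Sw).2.
have aZ := manifold_is_atlas Z.
apply: (near_eq_holomorphic_at aZ _ _ _ nE).
apply: (holomorphic_at_comp aZ (manifold_is_atlas Y)) => //.
by apply: hs; rewrite -pfg; exact: (pS _ Sz).1.
Qed.

(** The projection is a continuous lift through [p] of the holomorphic map [proj E \o q]. *)
Lemma pullback_proj_holomorphic_at (z : P) : holomorphic_at (proj P) z.
Proof.
apply: (holomorphic_at_section P _ (proj E \o q)).
- exact: fp_fst_continuous.
- by move=> w; rewrite /= pullback_eq.
- have [hE _ _ _ _] := vector_bundleP E.
  apply: holomorphic_at_comp; [exact: manifold_is_atlas..| |exact: hE].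
  exact: pullback_map_holomorphic_at.
Qed.

Lemma pullback_trivialization (y : Y') : exists (U : set Y') (r : nat)
    (h : P -> prod_space Y' r), [/\ open U, U y & is_trivialization P U h].
Proof.
have [_ p0 _ _ /(_ (p y))[U [r [h [oU Uy tU]]]]] := vector_bundleP E.
have [[oUE oUY hh hU [k [hk kU hK kK]]] h1 h0 ha hs] := tU.
have [S [V [s [Sy [oS _ pS _] hsec]]]] := covering_local_section p hp y.
have cp x : {for x, continuous p} by have [] := hp.1 x I.
have aY := manifold_is_atlas Y; have aY' := manifold_is_atlas Y'.
have aP := manifold_is_atlas P; have aE := manifold_is_atlas E.
(* Restricting to one sheet [S] lets the section [s] recover a base point in [Y'] from its image in
   [Y]. *)
pose U' := S `&` p @^-1` U.
have oU' : open U' by apply: openI => //; apply: open_comp => // x _; exact: cp.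
pose h' (z : P) : prod_space Y' r := (proj P z, (h (q z)).2).
pose k' (w : prod_space Y' r) : P :=
  insubd (vzero P y : {x | x \in [set z : Y' * E | p z.1 = proj E z.2]})
    (w.1, k (p w.1, w.2)).
have k'P (w : prod_space Y' r) : U' w.1 ->
    proj P (k' w) = w.1 /\ q (k' w) = k (p w.1, w.2).
  move=> [_ Uw].
  have Uk : U (proj E (k (p w.1, w.2))).
    by apply: kU; exists (p w.1, w.2).
  have Hk : (w.1, k (p w.1, w.2)) \in [set z : Y' * E | p z.1 = proj E z.2].
    by apply/mem_set; rewrite /= -h1 // kK //; exact/mem_set.
  have vE : val (k' w) = (w.1, k (p w.1, w.2)) by exact: (insubdK _ Hk).
  by split; [exact: (congr1 fst vE) | exact: (congr1 snd vE)].
exists U', r, h'; split=> //.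
split=> [|e _ //|x [_ Ux]|e e' [_ Ue] ee'|a e [_ Ue]].
- split.
  + apply: open_comp => // z _; exact: fp_fst_continuous.
  + by apply: (@open_comp _ _ fst) => // z _; exact: cvg_fst.
  + move=> z [Sz Uz].
    (* Writing [h'] as [sr \o (h \o q)] near [z] exhibits it as a composite of holomorphic maps. *)
    pose sr (w : prod_space Y r) : prod_space Y' r := (s w.1, w.2).
    have nE : \forall w \near z, (sr \o (h \o q)) w = h' w.
      have : nbhs z (proj P @^-1` U').
        by apply: fp_fst_continuous; exact: open_nbhs_nbhs.
      apply: filterS => w [Sw Uw].
      rewrite /sr /h' /= h1; last by rewrite pullback_eq.
      by rewrite pullback_eq (pS _ Sw).2.
    have Uq : U (proj E (q z)) by rewrite pullback_eq.
    apply: (near_eq_holomorphic_at aP _ _ _ nE).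
    apply: (holomorphic_at_comp aP (prod_space_is_atlas r aY)).
      apply: (holomorphic_at_comp aP aE).
        exact: pullback_map_holomorphic_at.
      exact: hh.
    apply: holomorphic_at_prod; apply: hsec.
    by rewrite /= h1 // pullback_eq; exact: (pS _ Sz).1.
  + by move=> _ [z Uz <-].
  + exists k'; split.
    * move=> w Uw.
      have nU : \forall v \near w, U' v.1.
        by apply: (near_fst w U'); exact: open_nbhs_nbhs.
      apply: holomorphic_at_pullback.
        apply: (@near_eq_continuous_at _ _ fst); last exact: cvg_fst.
        by apply: filterS nU => v Uv; exact: (esym (k'P v Uv).1).
      pose pr (w : prod_space Y' r) : prod_space Y r := (p w.1, w.2).
      have nE : \forall v \near w, (k \o pr) v = (q \o k') v.
        by apply: filterS nU => v Uv; exact: (esym (k'P v Uv).2).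
      have aYr' := prod_space_is_atlas r aY'.
      apply: (near_eq_holomorphic_at aYr' _ _ _ nE).
      apply: (holomorphic_at_comp aYr' (prod_space_is_atlas r aY)).
        by apply: holomorphic_at_prod; exact: hp.1.
      by apply: hk; case: Uw.
    * by move=> _ [w Uw <-]; rewrite /preimage /mkset (k'P w Uw).1.
    * move=> z /set_mem Uz; have [Sz Upz] := Uz.
      have Uq : U (proj E (q z)) by rewrite pullback_eq.
      have [k1 k2] := k'P (h' z) Uz; apply: fp_inj; first exact: k1.
      rewrite [LHS]k2 /h' /= -pullback_eq -h1 // -surjective_pairing hK //.
      exact/mem_set.
    * move=> w /set_mem Uw; have [k1 k2] := k'P w Uw.
      rewrite /h' k1 k2 kK; first by case: (w).
      by apply/mem_set; case: Uw.
- by rewrite /h' /= (h0 (p x)).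
- have [_ qa] := pullback_val_add e e' ee'.
  change ((h (q (vadd e e'))).2 = (h (q e)).2 + (h (q e')).2).
  by rewrite qa ha ?pullback_eq // ee'.
- change ((h (vscale a (q e))).2 = a *: (h (q e)).2).
  by rewrite hs // pullback_eq.
Qed.

Lemma pullback_is_vector_bundle : is_vector_bundle P.
Proof.
split=> //.
- by move=> z _; exact: pullback_proj_holomorphic_at.
- by move=> z w /pullback_val_add[].
- exact: pullback_trivialization.
Qed.

Definition pullback_bundle : vector_bundle Y' :=
  VectorBundle P pullback_is_vector_bundle.

End PullbackVectorBundle.

(** * Lifting sprays *)

Lemma real_complex_continuous {R : realType} :
  continuous (real_complex R : R -> cplx R).
Proof.
move=> t A /nbhs_ballP[e /= e0 eA]; apply/nbhs_ballP.
(* Radii of complex balls are complex numbers; a positive one is real, and its real part is the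
   radius used on the real side. *)
have [e1 e2] : complex.Im e = 0 /\ 0 < complex.Re e.
  by move: e0; rewrite ltcE /= => /andP[/eqP].
exists (complex.Re e) => // u; rewrite /ball /= => tu; apply: eA.
rewrite /ball /= -rmorphB /= normc_def /= expr0n addr0 sqrtr_sqr.
by rewrite ltcE /= e1 eqxx.
Qed.

Section LiftSpray.
Context {R : realType} {Y' Y : complex_manifold R}.
Variables (p : Y' -> Y) (hp : holomorphic_covering p).

(** Chain rule for [s \o p] and [p \o s], which are identities on [S] and on [V]. *)
Lemma mdiff_section (y : Y') (S : set Y') (V : set Y) (s : Y -> Y') :
  S y -> is_local_section p S V s ->
  (forall y, V y -> holomorphic_at s y) ->
  cancel (mdiff p y (p y)) (mdiff s (p y) y) /\
  cancel (mdiff s (p y) y) (mdiff p y (p y)).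
Proof.
move=> Sy [oS oV pS sV] hs; have [Vy sy] := pS _ Sy.
have aY' := manifold_is_atlas Y'; have aY := manifold_is_atlas Y.
have hpy : holomorphic_at p y by exact: hp.1.
split=> v.
- rewrite -(mdiff_comp aY' aY aY' p s) //; last exact: hs.
  apply: mdiff_near_id => //.
  have : nbhs y S by exact: open_nbhs_nbhs.
  by apply: filterS => z /pS[].
- rewrite -(mdiff_comp aY aY' aY s p) //; last exact: hs.
  apply: mdiff_near_id => //.
  have : nbhs (p y) V by exact: open_nbhs_nbhs.
  by apply: filterS => z /sV[].
Qed.

Lemma lift_spray (s : spray Y) : exists s' : spray Y',
  forall (y : Y') (v : tangent y),
    spray_image s (p y) (mdiff p y (p y) v) -> spray_image s' y v.
Proof.
pose E := spray_bundle s; pose P := pullback_bundle p hp E.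
pose q : P -> E := pullback_map p E.
have aY' := manifold_is_atlas Y'; have aY := manifold_is_atlas Y.
have aP := manifold_is_atlas P; have aE := manifold_is_atlas E.
have cs : continuous s by move=> e; have [] := spray_holomorphic s e I.
have hq (z : P) : holomorphic_at q z := pullback_map_holomorphic_at p hp E z.
have qeq (z : P) : proj E (q z) = p (proj P z) := pullback_eq p hp E z.
(* At time 0 this is [p] of the base point, so [proj P] lifts its start; at time 1 it is
   [s \o q]. *)
pose H (w : P * R) : Y := s (vscale (real_complex R w.2) (q w.1)).
have cH : continuous H.
  move=> w; apply: (@continuous_comp _ _ _
    (fun w : P * R => vscale (real_complex R w.2) (q w.1) : E) s);
    last exact: cs.
  apply: (@continuous_comp _ _ _
    (fun w : P * R => (real_complex R w.2 : cplx R, q w.1))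
    (fun u : cplx R * E => vscale u.1 u.2));
    last exact: bundle_scale_continuous.
  apply: continuous_pair.
    apply: (@continuous_comp _ _ _ snd (real_complex R : R -> cplx R)).
      exact: cvg_snd.
    exact: real_complex_continuous.
  apply: (@continuous_comp _ _ _ fst q); first exact: cvg_fst.
  by have [] := hq w.1.
have cf : continuous (proj P) by exact: bundle_proj_continuous.
have pf z : p (proj P z) = H (z, 0).
  by rewrite /H /= -qeq rmorph0 bundle_scale0 spray_zero.
have [F [cF pF Fu]] :=
  homotopy_lift_end p H (covering_topological p hp) cH _ cf pf.
have {}pF z : p (F z) = s (q z) by rewrite pF /H /= rmorph1 bundle_scale1.
have hs e : holomorphic_at s e by exact: spray_holomorphic.
have hF z : holomorphic_at F z.
  apply: (holomorphic_at_section p hp P F (s \o q)); first exact: cF.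
    exact: pF.
  exact: (holomorphic_at_comp aP aE q s z (hq z) (hs (q z))).
have F0 y : F (vzero P y) = y.
  apply: (Fu _ (fun=> y)) => [t _|]; last by rewrite bundle_proj_zero.
  split; first exact: cvg_cst.
  have -> : H (vzero P y, t) =
      s (vscale (real_complex R t) (vzero E (p y))) by [].
  by rewrite bundle_scale_zero spray_zero.
exists (Spray P F (fun z _ => hF z) F0) => y v [e ey se].
have pe : p y = proj E e by rewrite ey.
exists (fp_pair p (proj E) y e pe : P); first exact: erefl.
have [S [V [sec [Sy sS hsec]]]] := covering_local_section p hp y.
have [pK _] := mdiff_section y S V sec Sy sS hsec.
(* Since dp is injective, the two vectors are compared after applying it. *)
rewrite -[RHS]pK -[LHS]pK; congr (mdiff sec (p y) y _).
pose z : P := fp_pair p (proj E) y e pe.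
have FpE := mdiff_comp aP aY' aY F p (vzero P y) y (p y) (vertical y z)
  (esym (F0 y)) erefl (hF _) (hp.1 y I).
have pFE : p \o F = s \o q by apply/funext => w; exact: pF.
rewrite pFE in FpE.
have s0 : p y = s (q (vzero P y)) by rewrite [q _]/(vzero E (p y)) spray_zero.
have qsE := mdiff_lift (pullback_map p E) aE
  (pullback_local_homeomorphism p hp E) s (vzero P y) (p y)
  (vertical y z) s0 aY (hs _).
(* The vertical vector of (y, e) in the lifted chart converts to that of [e], since both chart and
   scaling on the pullback act through [q]. *)
exact: (etrans (esym FpE) (etrans qsE se)).
Qed.

End LiftSpray.

(** A decomposition of dp w on [Y] is carried back to [w] by the differential of a local section,
    which is linear and inverts dp. *)
Lemma lift_dominating {R : realType} {Y' Y : complex_manifold R} (p : Y' -> Y)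
    (k : nat) :
  holomorphic_covering p ->
  (exists s : 'I_k -> spray Y, dominating s) ->
  exists s : 'I_k -> spray Y', dominating s.
Proof.
move=> hp [s sdom].
have /choice[s' s'P] := fun j => lift_spray p hp (s j).
exists s' => y w; have [v vj wE] := sdom (p y) (mdiff p y (p y) w).
have [S [V [sec [Sy sS hsec]]]] := covering_local_section p hp y.
have [pK secK] := mdiff_section p hp y S V sec Sy sS hsec.
exists (fun j => mdiff sec (p y) y (v j)).
  by move=> j; apply: s'P; rewrite secK.
by rewrite -[w]pK wE /mdiff linear_sum.
Qed.

Theorem proposition1p6 (R : realType) (Y' Y : complex_manifold R)
    (p : Y' -> Y) (hp : holomorphic_covering p) :
  (subelliptic Y -> subelliptic Y') /\ (elliptic Y -> elliptic Y').
Proof.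
split=> [[k hk]|hk]; last exact: (lift_dominating p 1 hp hk).
by exists k; exact: (lift_dominating p k hp hk).
Qed.
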